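(* Let $M$ be a metrizable space of uncountable weight $w(M)$. (1) If $M$ is not locally compact then $\mathcal{K}(M)\ge_T\mathcal{K}(\mathbb{Q})$. (2) If $M$ is locally compact then $\mathcal{K}(M)\ge_T\mathcal{K}(\mathbb{Q})$ if and only if $w(M)\ge\mathfrak{d}$.
   Context: For directed sets $P,Q$, write $P\ge_T Q$ if there is a map $\phi:P\to Q$ carrying every cofinal subset of $P$ to a cofinal subset of $Q$. For a space $X$, $\mathcal{K}(X)$ is the set of compact subsets of $X$ ordered by inclusion. $\mathbb{Q}$ is the space of rationals. $w(M)$, the weight of $M$, is the minimal size of a basis of $M$. $\mathfrak{d}$ is the minimal size of a cofinal subset of $\omega^\omega$ with the coordinatewise order. *)

(* Defs.v *)
From mathcomp Require Import all_boot all_order all_algebra.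
From mathcomp Require Import all_classical all_reals all_analysis.

Set Implicit Arguments.
Unset Strict Implicit.
Unset Printing Implicit Defensive.

Import Order.TTheory GRing.Theory Num.Theory.
Import numFieldNormedType.Exports.

Local Open Scope classical_set_scope.
Local Open Scope card_scope.
Local Open Scope ring_scope.

(* The order need not be antisymmetric. *)
Record directedSet := DirectedSet {
  dsort :> Type;
  dle : dsort -> dsort -> Prop;
  dle_refl : forall p, dle p p;
  dle_trans : forall p q r, dle p q -> dle q r -> dle p r;
  dle_directed : forall p q, exists r, dle p r /\ dle q r }.

Definition cofinal (P : directedSet) (C : set P) : Prop :=
  forall p, exists2 c, C c & dle p c.

Definition tukey_ge (P Q : directedSet) : Prop :=
  exists phi : P -> Q, forall C : set P, cofinal C -> cofinal (phi @` C).

Section CompactSubsets.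
Variable X : topologicalType.

Let kset := {A : set X | compact A}.
Let kle (A B : kset) : Prop := sval A `<=` sval B.

Let kle_refl (A : kset) : kle A A. Proof. by []. Qed.

Let kle_trans (A B C : kset) : kle A B -> kle B C -> kle A C.
Proof. exact: subset_trans. Qed.

Let kle_directed (A B : kset) : exists C, kle A C /\ kle B C.
Proof.
case: A B => [A cA] [B cB]; exists (exist _ (A `|` B) (compactU cA cB)).
by split; [exact: subsetUl | exact: subsetUr].
Qed.

Definition K : directedSet := DirectedSet kle_refl kle_trans kle_directed.

End CompactSubsets.

Section OmegaOmega.

Let fle (f g : nat -> nat) : Prop := forall n, (f n <= g n)%N.

Let fle_refl f : fle f f. Proof. by move=> n. Qed.

Let fle_trans f g h : fle f g -> fle g h -> fle f h.
Proof. by move=> fg gh n; exact: leq_trans (fg n) (gh n). Qed.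

Let fle_directed f g : exists h, fle f h /\ fle g h.
Proof.
by exists (fun n => maxn (f n) (g n)); split=> n; rewrite ?leq_maxl ?leq_maxr.
Qed.

Definition omega_omega : directedSet :=
  DirectedSet fle_refl fle_trans fle_directed.

End OmegaOmega.

(* Cardinals are represented by sets, compared with #<=: the minimal size of a
   member of a nonempty family F is represented by a member of F of least
   cardinality, which exists by min_sizeP. *)
Definition min_size (T : Type) (F : set (set T)) : set T :=
  xget set0 [set A | F A /\ forall B, F B -> A #<= B].

Lemma min_size_ex (T : Type) (F : set (set T)) :
  F !=set0 -> exists A, F A /\ forall B, F B -> A #<= B.
Proof.
move=> [A0 FA0].
pose ok (S : set (set T -> T)) := forall B, F B ->
  (forall f, S f -> B (f B)) /\ (forall f g, S f -> S g -> f B = g B -> f = g).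
have [S [okS maxS]] : exists S, ok S /\ forall S', S `<` S' -> ~ ok S'.
  apply: Zorn_bigcup => G Gok Gtot B FB; split.
    by move=> f [S GS Sf]; exact: (Gok _ GS _ FB).1.
  move=> f g [S GS Sf] [S' GS' S'g].
  have [SS'|S'S] := Gtot _ _ GS GS'.
    by apply: (Gok _ GS' _ FB).2 => //; exact: SS'.
  by apply: (Gok _ GS _ FB).2 => //; exact: S'S.
have [[B [FB BS]]|nB] :=
    pselect (exists B, F B /\ B `<=` (fun f : set T -> T => f B) @` S).
  exists B; split=> // B' FB'.
  apply: card_le_trans (subset_card_le BS) _.
  apply: card_le_trans (card_image_le _ _) _.
  have evS : (fun f : set T -> T => f B') @` S #= S.
    apply: inj_card_eq => f g /set_mem Sf /set_mem Sg.
    exact: (okS _ FB').2.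
  rewrite -(card_le_eql evS); apply: subset_card_le => _ [f Sf <-].
  exact: (okS _ FB').1.
have miss B : F B -> exists b, B b /\ ~ ((fun f : set T -> T => f B) @` S) b.
  move=> FB; apply: contrapT => nb; apply: nB; exists B; split=> // b Bb.
  by apply: contrapT => nS; apply: nb; exists b.
have [t0 _] := miss _ FA0.
have /choice[h hP] : forall B, exists b,
    F B -> B b /\ ~ ((fun f : set T -> T => f B) @` S) b.
  move=> B; have [/miss[b bP]|nFB] := pselect (F B); first by exists b.
  by exists t0.
exfalso; apply: (maxS (S `|` [set h])).
  split; first by move=> f Sf; left.
  move=> hS; have [_] := hP _ FA0; apply; exists h => //.
  by apply: hS; right.
move=> B FB; have [Bh hS] := hP _ FB; split=> [f [/((okS _ FB).1)//|->//]|].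
move=> f g [Sf|->] [Sg|->] // fg.
- exact: (okS _ FB).2 fg.
- by exfalso; apply: hS; exists f.
- by exfalso; apply: hS; exists g.
Qed.

Lemma min_sizeP (T : Type) (F : set (set T)) : F !=set0 ->
  F (min_size F) /\ forall B, F B -> min_size F #<= B.
Proof.
by move=> /min_size_ex ex; exact: (xgetPex set0 ex).
Qed.

Definition weight (M : topologicalType) : set (set M) := min_size (@basis M).
Arguments weight M : clear implicits.

Lemma weightP (M : topologicalType) :
  basis (weight M) /\ forall B : set (set M), basis B -> weight M #<= B.
Proof.
apply: min_sizeP; exists open; split=> // x U.
by rewrite nbhsE => -[V [oV Vx] VU]; exists V.
Qed.

Definition dominating_number : set (nat -> nat) :=
  min_size (@cofinal omega_omega).

Lemma dominating_numberP :
  @cofinal omega_omega dominating_number /\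
  forall C, @cofinal omega_omega C -> dominating_number #<= C.
Proof. by apply: min_sizeP; exists setT => f; exists f => // n. Qed.

Definition metrizable (R : realType) (M : topologicalType) : Prop :=
  exists d : M -> M -> R,
    [/\ forall x y, d x y = 0 <-> x = y,
        forall x y, d x y = d y x,
        forall x y z, d x z <= d x y + d y z &
        forall x A, nbhs x A <->
          exists2 e : R, 0 < e & [set y | d x y < e] `<=` A].

(* rat carries no topology in the library; rat^o has that of the metric |x-y|,
   which is the topology of Q as a subspace of the real line. *)
Definition Qspace : topologicalType := rat^o.

(* Main.v *)
Require Import Defs.
From mathcomp Require Import all_boot all_order all_algebra.
From mathcomp Require Import all_classical all_reals all_analysis.
From mathcomp Require wochoice.
From mathcomp Require Import lra.

(* Any uncountable set D contains a copy W of omega_1. By recursion along W one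
   builds compact sets hull t f of rationals, for t in W and f in omega^omega,
   increasing in f and together cofinal in K(Q): a compact
   set of rationals is scattered, so it is assembled, in countably many steps,
   from pieces lying in annuli that shrink to an accumulation point. Hence K(Q)
   is a Tukey quotient of K(M) as soon as a compact subset of M yields, cofinally,
   a finite subset of D and an element of omega^omega.

   If M has uncountable weight, it has an uncountable uniformly separated set,
   whose traces on compact sets are finite. If moreover M is not locally compact
   at p, each ball around p contains a sequence meeting every compact set finitely
   often, and this gives the element of omega^omega. If instead the weight is at
   least the dominating number, elements of a dominating family are indexed by
   pairs (n, x) with x in a maximal 1/(n+1)-separated set, and both the point of D
   and the element of omega^omega are taken from that family.

   Conversely, if M is locally compact, finite unions of basic open sets show that
   K(M) has a cofinal set of size w(M), while K(Q), Q not being locally compact,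
   maps onto a dominating family. *)

Set Implicit Arguments.
Unset Strict Implicit.
Unset Printing Implicit Defensive.

Import Order.TTheory GRing.Theory Num.Theory.

Local Open Scope classical_set_scope.
Local Open Scope card_scope.
Local Open Scope ring_scope.

(** * Cardinality *)

(** Fix a well-order of [T]. If some initial segment of [D] is uncountable, [W] is the one below the
    least such point; otherwise [W] is [D]. Either way the proper initial segments of [W] are
    countable. *)
Lemma omega1_relation (T : eqType) (D : set T) : ~ countable D ->
  exists (W : set T) (lt : T -> T -> Prop),
  [/\ W `<=` D, W !=set0, well_founded lt, forall t, countable [set s | lt s t]
    & forall u : nat -> T, (forall n, W (u n)) ->
        exists2 t, W t & forall n, lt (u n) t].
Proof.
move=> uD; have [R woR] := wochoice.well_ordering_principle T.
have minR (A : set T) : A !=set0 -> exists2 z, A z & forall x, A x -> R z x.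
  move=> [a Aa]; have [|z [[/asboolP Az lbz] _]] := woR (fun x => `[< A x >]).
    by exists a; apply/asboolP.
  by exists z => // x Ax; apply: lbz; apply/asboolP.
have woT : wochoice.wo_chain R predT by move=> A _; exact: woR.
have antiR x y : R x y -> R y x -> x = y.
  move=> Rxy Ryx; apply: (wochoice.wo_chain_antisymmetric woT) => //.
  by rewrite Rxy Ryx.
have totR x y : R x y \/ R y x.
  by apply/orP; exact: (wochoice.wo_chainW woT).
pose below t := D `&` [set s | R s t /\ s <> t].
have [W [WD uW cW]] : exists W : set T, [/\ W `<=` D, ~ countable W &
    forall t, W t -> countable (W `&` below t)].
  have [[t0 ut0]|nbad] := pselect (exists t, ~ countable (below t)).
    have [t utt tmin] := minR [set t | ~ countable (below t)] (ex_intro _ t0 ut0).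
    exists (below t); split=> // [x []//|s [_ [Rst st]]].
    apply: contrapT => us; apply: st; apply: antiR => //; apply: tmin => cs.
    by apply: us; apply: sub_countable cs; apply: subset_card_le => ? [].
  exists D; split=> // t _; apply: contrapT => ut; apply: nbad; exists t => cs.
  by apply: ut; apply: sub_countable cs; apply: subset_card_le => ? [].
pose lt s t := [/\ W s, W t, R s t & s <> t].
exists W, lt; split.
- exact: WD.
- by apply/set0P/negP => /eqP W0; apply: uW; rewrite W0; exact: countable0.
- move=> a; apply: contrapT => na.
  have [z nz zmin] := minR [set x | ~ Acc lt x] (ex_intro _ a na).
  apply: nz; constructor => y [_ _ Ryz yz]; apply: contrapT => ny.
  by apply: yz; apply: antiR => //; exact: zmin.
- move=> t; have [Wt|nWt] := pselect (W t).
    apply: sub_countable (cW _ Wt); apply: subset_card_le => s [Ws _ Rst st].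
    by split=> //; split=> //; exact: WD.
  apply: sub_countable (countable0 T); apply: subset_card_le => s [_ Wt].
  by have := nWt Wt.
- move=> u Wu; apply: contrapT => nt; apply: uW.
  (* If no [t] lay above every [u n], the points [u n] and the countable segments below them would
     cover [W]. *)
  have: countable (\bigcup_(p : nat * bool)
      if p.2 then W `&` below (u p.1) else [set u p.1]).
    apply: bigcup_countable => // -[n []] _ /=; [exact: cW | exact: countable1].
  apply: sub_countable; apply: subset_card_le => t Wt; apply: contrapT => nu.
  apply: nt; exists t => // n; have tu : u n <> t.
    by move=> tu; apply: nu; exists (n, false).
  split=> //; have [//|Rtu] := totR (u n) t; exfalso; apply: nu.
  by exists (n, true) => //; split=> //; split; [exact: WD | split=> // /esym].
Qed.

Definition seqs_in (T : eqType) (X : set T) : set (seq T) :=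
  [set s : seq T | forall x, x \in s -> X x].

(* Each letter of C is replaced by two letters of A, tagged by a1. *)
Lemma seqs_in_setU (T : eqType) (A C : set T) (k : T -> T) (a0 a1 : T) :
  A a0 -> A a1 -> a0 <> a1 -> (forall x, C x -> A (k x)) ->
  (forall x y, C x -> C y -> k x = k y -> x = y) ->
  exists e : seq T -> seq T,
    (forall s, seqs_in (A `|` C) s -> seqs_in A (e s)) /\
    (forall s t, seqs_in (A `|` C) s -> seqs_in (A `|` C) t -> e s = e t -> s = t).
Proof.
move=> Aa0 Aa1 a01 kA kI.
pose c x := if `[< A x >] then [:: a0; x] else [:: a1; k x].
exists (fun s => flatten [seq c x | x <- s]); split=> [s|].
  elim: s => [//|x s IHs] sAC y; rewrite /= mem_cat => /orP[|]; last first.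
    by apply: IHs => z zs; apply: sAC; rewrite inE zs orbT.
  rewrite /c; case: asboolP => Ax; rewrite !inE => /orP[]/eqP-> //.
  by apply: kA; have [//|] := sAC x (mem_head _ _).
elim=> [|x s IHs] [|y t] //=; rewrite /c.
- by case: ifP.
- by case: ifP.
move=> xsAC ytAC; have := ytAC y (mem_head _ _); have := xsAC x (mem_head _ _).
move=> xAC yAC; have sAC : seqs_in (A `|` C) s.
  by move=> z zs; apply: xsAC; rewrite inE zs orbT.
have tAC : seqs_in (A `|` C) t.
  by move=> z zs; apply: ytAC; rewrite inE zs orbT.
case: asboolP => Ax; case: asboolP => Ay [].
- by move=> -> /(IHs _ sAC tAC) ->.
- by move=> /a01.
- by move=> /esym/a01.
- have [//|Cx] := xAC; have [//|Cy] := yAC.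
  by move=> /(kI _ _ Cx Cy) -> /(IHs _ sAC tAC) ->.
Qed.

(** Zorn's lemma, on pairs of an infinite subset A of [X] and an injection of the finite sequences
    in A into A. For a maximal pair, [X] minus A embeds in A, as otherwise the injection would
    extend to A together with a disjoint copy of it. *)
Lemma card_seqs_in (T : pointedType) (X : set T) : infinite_set X ->
  seqs_in X #<= X.
Proof.
move=> iX.
pose ok (p : set T * (seq T -> T)) := [/\ p.1 `<=` X, infinite_set p.1,
  forall s, seqs_in p.1 s -> p.1 (p.2 s) &
  forall s t, seqs_in p.1 s -> seqs_in p.1 t -> p.2 s = p.2 t -> s = t].
pose P := {p | ok p}.
pose Rb (p q : P) := `[< (sval p).1 `<=` (sval q).1 /\
  forall s, seqs_in (sval p).1 s -> (sval p).2 s = (sval q).2 s >].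
(* A countably infinite subset of [X] gives a first pair, sequences being coded by [pickle]. *)
have [p0 _] : exists p0 : P, True.
  have /infiniteP/pcard_leP[u] := iX.
  pose v x := xget 0%N [set n | u n = x].
  have uK : cancel u v.
    move=> n; rewrite /v; case: xgetP => [m _ /=|/(_ n) []//].
    by apply: (@inj _ _ _ u); rewrite inE.
  suff ok0 : ok (range u, fun s => u (pickle (map v s))).
    by exists (exist ok _ ok0).
  split=> /=.
  - by move=> _ [n _ <-]; exact: funS.
  - by apply/infiniteP; rewrite (card_le_eqr (inj_card_eq _)).
  - by move=> s _; exists (pickle (map v s)).
  - move=> s t su tu /(congr1 v); rewrite !uK => /(pcan_inj pickleK).
    have K r : seqs_in (range u) r -> map u (map v r) = r.
      elim: r => //= x r IHr xr; rewrite IHr; last first.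
        by move=> y yr; apply: xr; rewrite inE yr orbT.
      by have [n _ <-] := xr x (mem_head _ _); rewrite uK.
    by move=> /(congr1 (map u)); rewrite !K.
have [] := @ZL_preorder P p0 Rb.
- by move=> p; apply/asboolP; split.
- move=> q p r /asboolP[pq fpq] /asboolP[qr fqr]; apply/asboolP; split.
    exact: subset_trans qr.
  by move=> s ss; rewrite fpq// fqr// => x /ss/pq.
- move=> C Ctot; have [C0|/set0P[c0 Cc0]] := eqVneq C set0.
    by exists p0 => s; rewrite C0.
  pose A := \bigcup_(p in C) (sval p).1.
  have inC s : seqs_in A s -> exists2 p, C p & seqs_in (sval p).1 s.
    elim: s => [_|x s IHs xs]; first by exists c0.
    have [|p Cp sp] := IHs; first by move=> y ys; apply: xs; rewrite inE ys orbT.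
    have [q Cq qx] := xs x (mem_head _ _).
    have [/asboolP[pq _]|/asboolP[qp _]] := Ctot _ _ Cp Cq.
      by exists q => // y; rewrite inE => /orP[/eqP->//|/sp/pq].
    by exists p => // y; rewrite inE => /orP[/eqP->|/sp//]; exact: qp.
  have /choice[f fP] : forall s, exists y,
      forall p, C p -> seqs_in (sval p).1 s -> y = (sval p).2 s.
    move=> s; have [[p [Cp sp]]|ns] := pselect (exists p, C p /\ seqs_in (sval p).1 s).
      exists ((sval p).2 s) => q Cq sq.
      have [/asboolP[_ ->]//|/asboolP[_ ->]//] := Ctot _ _ Cp Cq.
    by exists point => p Cp sp; exfalso; apply: ns; exists p.
  suff okA : ok (A, f).
    exists (exist ok _ okA) => p Cp; apply/asboolP; split=> /= [x|s sp].
      by exists p.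
    by rewrite (fP s p).
  split=> /=.
  - by move=> x [p _]; have [+ _ _ _] := svalP p; apply.
  - have [_ + _ _] := svalP c0; apply: sub_infinite_set => x; by exists c0.
  - move=> s /inC[p Cp sp]; exists p => //; rewrite (fP s p)//.
    by have [_ _ + _] := svalP p; apply.
  - move=> s t /inC[p Cp sp] /inC[q Cq tq].
    have [/asboolP[pq _]|/asboolP[qp _]] := Ctot _ _ Cp Cq.
      have sq : seqs_in (sval q).1 s by move=> x /sp/pq.
      rewrite (fP s q)// (fP t q)//; by have [_ _ _] := svalP q; apply.
    have tp : seqs_in (sval p).1 t by move=> x /tq/qp.
    rewrite (fP s p)// (fP t p)//; by have [_ _ _] := svalP p; apply.
move=> [[A f] okA] maxA; have [/= AX iA fA fI] := okA.
have [a0 Aa0] := infinite_setN0 iA.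
have [a1 [Aa1 a10]] : (A `\ a0) !=set0.
  by apply: infinite_setN0; apply: infinite_setD => //; exact: finite_set1.
have a01 : a0 <> a1 by move=> a01; apply: a10.
(* Comparability of two cardinals: a two-element family has a least member. *)
have [minF lemin] := @min_sizeP T [set A; X `\` A] (ex_intro _ A (or_introl erefl)).
have : A #<= X `\` A \/ X `\` A #<= A.
  by case: minF lemin => -> lemin; [left|right]; apply: lemin; [right|left].
case=> /pcard_leP[j]; last first.
  have [||e [eA eI]] := @seqs_in_setU T A (X `\` A) j a0 a1 Aa0 Aa1 a01.
  - by move=> x ?; exact: funS.
  - by move=> x y ? ? /inj; apply; rewrite inE.
  have XE : A `|` (X `\` A) = X by exact: setDUK.
  apply/pcard_leP; apply/injfunPex; exists (f \o e) => [s sX|s t].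
    by apply/AX/fA/eA; rewrite XE.
  by move=> /set_mem sX /set_mem tX /fI st; apply: eI; rewrite ?XE//;
    apply: st; apply: eA; rewrite XE.
pose k x := xget a0 [set a | A a /\ j a = x].
have kP x : (j @` A) x -> A (k x) /\ j (k x) = x.
  by move=> [a Aa jax]; rewrite /k; case: xgetP => [y _ //|/(_ a)[]].
have [||e [eA eI]] := @seqs_in_setU T A (j @` A) k a0 a1 Aa0 Aa1 a01.
- by move=> x /kP[].
- by move=> x y /kP[_ {2}<-] /kP[_ {2}<-] ->.
(* Sequences not in [A] are recoded in [A] by [e] and sent into the copy of [A] under [j], away from
   the values of [f]. *)
pose g s := if `[< seqs_in A s >] then f s else j (f (e s)).
have jA a : A a -> X (j a) /\ ~ A (j a).
  by move=> Aa; have [] : (X `\` A) (j a) by exact: funS.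
have okB : ok (A `|` j @` A, g).
  split=> /=.
  - by move=> x [/AX//|[a Aa <-]]; have [] := jA a Aa.
  - by apply: sub_infinite_set iA => x; left.
  - move=> s sB; rewrite /g; case: asboolP => sA; first by left; exact: fA.
    by right; exists (f (e s)) => //; apply: fA; exact: eA.
  - move=> s t sB tB; rewrite /g; case: asboolP => sA; case: asboolP => tA.
    + exact: fI.
    + move=> fj; have [|_ []] := jA (f (e t)); first exact/fA/eA.
      by rewrite -fj; exact: fA.
    + move=> fj; have [|_ []] := jA (f (e s)); first exact/fA/eA.
      by rewrite fj; exact: fA.
    + move=> /inj jI; apply: eI => //; apply: fI; try exact: eA.
      by apply: jI; rewrite inE; apply/fA/eA.
have /asboolP[BA _] : Rb (exist ok _ okB) (exist ok (A, f) okA).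
  apply: maxA; apply/asboolP; split=> /= [x|s sA]; first by left.
  by rewrite /g; case: asboolP.
by have [_ []] := jA a0 Aa0; apply: BA; right; exists a0.
Qed.

(** * Tukey quotients and compact sets *)

(** Any choice function for [r] is a witness: it sends everything above some p to elements above q.
    A relation leaves room for auxiliary choices, such as bounds, in the image. *)
Lemma tukey_geI (P Q : directedSet) (r : P -> Q -> Prop) :
  (forall p, exists q, r p q) ->
  (forall q, exists p, forall p' q', dle p p' -> r p' q' -> dle q q') ->
  tukey_ge P Q.
Proof.
move=> /choice[phi phiP] cof; exists phi => C Ccof q.
have [p pP] := cof q; have [p' Cp' pp'] := Ccof p.
by exists (phi p'); [exists p' | exact: pP (phiP p')].
Qed.

Lemma tukey_ge_trans (P Q S : directedSet) :
  tukey_ge P Q -> tukey_ge Q S -> tukey_ge P S.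
Proof.
move=> [f fP] [g gP]; exists (g \o f) => C /fP/gP.
by rewrite image_comp.
Qed.

(** If [P A] failed, the sets whose complement in [A] satisfies [P] would form a proper filter, and
    the local hypothesis at a cluster point in [A] would contradict this. *)
Lemma compact_ind (X : topologicalType) (P : set X -> Prop) (A : set X) :
  P set0 -> (forall B C, P B -> P C -> P (B `|` C)) ->
  (forall B C, B `<=` C -> P C -> P B) ->
  compact A -> (forall x, A x -> exists2 U, nbhs x U & P (A `&` U)) -> P A.
Proof.
move=> P0 PU Psub cA loc; apply: contrapT => nPA.
pose F : set (set X) := [set B | P (A `\` B)].
have FF : ProperFilter F.
  split; first by rewrite /F /= setD0.
  split; first by rewrite /F /= setDT.
    by move=> B C PB PC; rewrite /F /= setDIr; exact: PU.
  by move=> B C BC; apply: Psub; exact: setDS.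
have [|x [Ax clx]] := cA F FF; first by rewrite /F /= setDv.
have [U Ux PAU] := loc x Ax.
have [|y []] := clx (~` U) U _ Ux; last by [].
by rewrite /F /= setDE setCK.
Qed.

(** A filter not clustering at [x] has a member missing a neighbourhood of [x]; inside the union
    this leaves only finitely many [C n], whose union is compact. *)
Lemma compact_cvg_bigcup (X : topologicalType) (x : X) (C : nat -> set X) :
  (forall n, compact (C n)) ->
  (forall U, nbhs x U -> exists N, forall n, (N <= n)%N -> C n `<=` U) ->
  compact ([set x] `|` \bigcup_n C n).
Proof.
move=> cC cvgC F FF FA.
have [clx|ncl] := pselect (cluster F x); first by exists x; split=> //; left.
have [B [U [FB Ux BU]]] : exists B U, [/\ F B, nbhs x U & B `&` U = set0].
  apply: contrapT => nBU; apply: ncl => B U FB Ux; apply/set0P/eqP => BU.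
  by apply: nBU; exists B, U.
have [N NU] := cvgC U Ux.
have [||y [yC cly]] := @bigsetU_compact X nat C (iota 0 N) xpredT _ F FF.
- by move=> *; exact: cC.
- apply: filterS (filterI FB FA) => y [By [yx|[n _ Cny]]].
    suff : (B `&` U) y by rewrite BU.
    by split=> //; rewrite yx; exact: nbhs_singleton.
  rewrite -bigcup_seq; exists n => //=; rewrite mem_iota /= add0n ltnNge.
  apply/negP => /NU/(_ y Cny) Uy.
  by suff : (B `&` U) y by rewrite BU.
exists y; split=> //; right; move: yC; rewrite -bigcup_seq => -[n _ Cny].
by exists n.
Qed.

Lemma compact_finite_preimage (X : topologicalType) (I : Type) (f : I -> X)
    (A : set X) :
  (forall x, A x -> exists2 U, nbhs x U & finite_set (f @^-1` U)) ->
  compact A -> finite_set (f @^-1` A).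
Proof.
move=> lf cA; apply: (@compact_ind X (fun B => finite_set (f @^-1` B))) => //.
- by move=> B C; rewrite preimage_setU finite_setU.
- by move=> B C BC; apply: sub_finite_set => i; exact: BC.
- move=> x /lf[U Ux fU]; exists U => //.
  by apply: sub_finite_set fU => i [].
Qed.

Lemma finite_set_ubound (A : set nat) : finite_set A ->
  exists N, forall n, A n -> (n <= N)%N.
Proof.
move=> /finite_fsetP[S ->]; exists (\max_(i <- finmap.enum_fset S) i)%N => n nS.
exact: (@leq_bigmax_seq _ _ xpredT id).
Qed.

Lemma compact_bigcup_finite (X : topologicalType) (I : choiceType) (D : set I)
    (C : I -> set X) :
  finite_set D -> (forall i, D i -> compact (C i)) ->
  compact (\bigcup_(i in D) C i).
Proof.
move=> fD cC; rewrite -bigsetU_fset_set// big_seq.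
by apply: bigsetU_compact => i; rewrite in_fset_set// inE; exact: cC.
Qed.

(** * Compact sets of rationals *)

Lemma nbhs_QspaceP (q : rat) (U : set rat) :
  nbhs (q : Qspace) U <->
  exists2 e : rat, 0 < e & [set x | `|q - x| < e] `<=` U.
Proof.
split=> [/nbhs_ballP[e /= e0 eU]|[e e0 eU]].
  by exists e => // x qx; apply: eU.
by apply/nbhs_ballP; exists e => // x qx; exact: eU.
Qed.

Lemma nbhs_Qspace_ball (q e : rat) : 0 < e ->
  nbhs (q : Qspace) [set x : rat | `|q - x| < e].
Proof. by move=> e0; apply/nbhs_QspaceP; exists e. Qed.

Lemma closed_Qspace_ball (q e : rat) :
  closed ([set x : rat | `|q - x| <= e] : set Qspace).
Proof.
move=> x clx /=; rewrite leNgt; apply/negP => ltx.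
have e0 : 0 < `|q - x| - e by rewrite subr_gt0.
have [y [/= yq]] := clx _ (nbhs_Qspace_ball _ e0).
apply/negP; rewrite -leNgt lerBlDr.
apply: le_trans (ler_distD (y : rat) (q : rat) x) _.
by rewrite (distrC (y : rat)) addrC lerD2l.
Qed.

Definition ratn (n : nat) : rat := odflt 0 (unpickle n).

Lemma ratn_pickle q : ratn (pickle q) = q.
Proof. by rewrite /ratn pickleK. Qed.

(* A Baire category argument: were no point of A isolated, nested balls centred
   in A could avoid the n-th rational at the n-th step. *)
Lemma compact_Qspace_isolated (A : set Qspace) : compact A -> A !=set0 ->
  exists2 q : rat, A q &
    exists2 e : rat, 0 < e & forall x, A x -> `|q - x| < e -> x = q.
Proof.
move=> cA [a Aa]; apply: contrapT => niso.
have acc (q e : rat) : A q -> 0 < e ->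
    exists2 x : rat, A x & `|q - x| < e /\ x <> q.
  move=> Aq e0; apply: contrapT => nx; apply: niso; exists q => //.
  exists e => // x Ax qx; apply: contrapT => xq; apply: nx.
  by exists x.
(* From a ball centred in [A], pass to a ball inside it, again centred in [A], that misses the n-th
   rational. *)
have /choice[step stepP] : forall s : nat * (rat * rat), exists t : rat * rat,
    A s.2.1 -> 0 < s.2.2 -> [/\ A t.1, 0 < t.2,
      `|s.2.1 - t.1| + t.2 <= s.2.2 & t.2 < `|t.1 - ratn s.1| ].
  move=> [n [c r]] /=; have [[Ac r0]|nAr] := pselect (A c /\ 0 < r); last first.
    by exists (c, r) => Ac r0; exfalso; apply: nAr.
  have [c' [Ac' cc' c'n]] : exists c' : rat,
      [/\ A c', `|c - c'| < r & c' != ratn n].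
    have [cn|cn] := eqVneq c (ratn n); last by exists c; rewrite subrr normr0.
    have [x Ax [cx xc]] := acc _ _ Ac r0; exists x; split=> //.
    by rewrite -cn; apply/eqP.
  have d0 : 0 < `|c' - ratn n| by rewrite normr_gt0 subr_eq0.
  (* The first term keeps the new ball inside the old one, the second keeps [ratn n] out. *)
  exists (c', Num.min (r - `|c - c'|) (`|c' - ratn n| / 2)) => _ _ /=; split=> //.
  - by rewrite lt_min subr_gt0 cc' divr_gt0.
  - by rewrite -lerBrDl ge_min lexx.
  - by rewrite gt_min [X in _ || X]ltr_pdivrMr// ltr_pMr// ltr1n orbT.
pose st := fix st n : rat * rat := if n is m.+1 then step (m, st m) else (a, 1).
have stP n : A (st n).1 /\ 0 < (st n).2.
  by elim: n => [//|n [An rn]] /=; have [] := stepP (n, st n) An rn.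
have stS n := let: conj An rn := stP n in stepP (n, st n) An rn.
have nest n k : `|(st n).1 - (st (n + k)%N).1| + (st (n + k)%N).2 <= (st n).2.
  elim: k => [|k IHk]; first by rewrite addn0 subrr normr0 add0r.
  rewrite addnS; have [_ _ le1 _] := stS (n + k)%N.
  apply: le_trans IHk; rewrite -[st (n + k).+1]/(step (_, st (n + k)%N)).
  have := ler_distD (st (n + k)%N).1 (st n).1 (step ((n + k)%N, st (n + k)%N)).1.
  by move=> tri; apply: le_trans (lerD tri (lexx _)) _; rewrite -addrA lerD2l.
pose F : set (set Qspace) := [set B | exists n, forall k, B (st (n + k)%N).1].
have FF : ProperFilter F.
  split; first by move=> [n /(_ 0%N)].
  split; first by exists 0%N.
    move=> B C [n nB] [m mC]; exists (n + m)%N => k; split.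
      by rewrite -addnA; exact: nB.
    by rewrite (addnC n) -addnA; exact: mC.
  by move=> B C BC [n nB]; exists n => k; exact/BC/nB.
have [|x [Ax clx]] := cA F FF; first by exists 0%N => k; have [] := stP (0 + k)%N.
have xin n : `|(st n).1 - x| <= (st n).2.
  rewrite leNgt; apply/negP => lt_x.
  have [||_ [[k <-] /=]] := clx [set y | exists k, (st (n + k)%N).1 = y]
      [set y | `|x - y| < `|(st n).1 - x| - (st n).2].
  - by exists n => k; exists k.
  - by apply: nbhs_Qspace_ball; rewrite subr_gt0.
  apply/negP; rewrite -leNgt lerBlDr.
  apply: le_trans (ler_distD (st (n + k)%N).1 _ _) _; rewrite addrC distrC lerD2l.
  by apply: le_trans (nest n k); rewrite lerDl ltW//; have [] := stP (n + k)%N.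
(* The cluster point [x] lies in every ball, yet as a rational it was excluded at stage
   [pickle x]. *)
have [_ _ _] := stS (pickle x).
by rewrite ltNge ratn_pickle => /negP; apply; exact: (xin (pickle x).+1).
Qed.

(** The distances from 1/(n+1) to 1/n, both included so that the set is closed; in product form, n =
    0 has no upper bound. *)
Definition annulus i n : set rat :=
  [set q | n%:R * `|ratn i - q| <= 1 <= n.+1%:R * `|ratn i - q|].

Lemma closed_annulus i n : closed (annulus i n : set Qspace).
Proof.
move=> p clp; apply/andP; split; rewrite leNgt; apply/negP => lt1.
  have e0 : 0 < (n%:R * `|ratn i - p| - 1) / n.+1%:R.
    by rewrite divr_gt0// subr_gt0.
  have [q [/andP[q1 _] /=]] := clp _ (nbhs_Qspace_ball _ e0).
  apply/negP; rewrite -leNgt ler_pdivrMr//.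
  have := ler_distD q (ratn i) p; rewrite (distrC q p).
  have := normr_ge0 (p - q); have : (0 : rat) <= n%:R by [].
  rewrite -natr1; move: q1 lt1; set u := `|_ - q|; set v := `|_ - p|.
  set w := `|_|; set N := n%:R; nra.
have e0 : 0 < (1 - n.+1%:R * `|ratn i - p|) / n.+1%:R.
  by rewrite divr_gt0// subr_gt0.
have [q [/andP[_ q1] /=]] := clp _ (nbhs_Qspace_ball _ e0).
apply/negP; rewrite -leNgt ler_pdivrMr//.
have := ler_distD p (ratn i) q.
have := normr_ge0 (p - q); have : (0 : rat) <= n%:R by [].
rewrite -natr1 in q1 lt1 *; move: q1 lt1; set u := `|_ - q|; set v := `|_ - p|.
set w := `|_|; set N := n%:R; nra.
Qed.

Lemma annulus_cover i q : q <> ratn i -> exists n, annulus i n q.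
Proof.
move=> /eqP qi; have d0 : 0 < `|ratn i - q| by rewrite normr_gt0 subr_eq0 eq_sym.
exists (Num.truncn `|ratn i - q|^-1).
have /andP[le1 lt1] := truncn_itv (ltW (etrans (invr_gt0 _) d0)).
rewrite /annulus /= -ler_pdivlMr// div1r le1/=.
by rewrite -ler_pdivrMr// div1r ltW.
Qed.

Lemma annulus_small i (e : rat) : 0 < e ->
  exists N, forall n, (N <= n)%N -> annulus i n `<=` [set q | `|ratn i - q| < e].
Proof.
move=> e0; exists (Num.truncn e^-1).+1 => n Nn q /andP[+ _] /=.
have lt1 : 1 < n%:R * e.
  rewrite -ltr_pdivrMr// div1r; apply: lt_le_trans (truncnS_gt _) _.
  by rewrite ler_nat.
apply: contraTT; rewrite -leNgt -ltNge => le_e; apply: lt_le_trans lt1 _.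
by rewrite ler_wpM2l.
Qed.

Section Hulls.
Variables (T : Type) (lt : T -> T -> Prop) (e : T -> nat -> T).
Hypothesis lt_wf : well_founded lt.
Hypothesis e_surj : forall s t, lt s t -> exists j, e t j = s.

Definition slice (f : nat -> nat) (n : nat) : nat -> nat :=
  fun k => f (pickle (n, k)).

(* Think of t as a countable ordinal whose predecessors are the e t j: the sets
   hull t f, for varying f, absorb all compacta of Cantor-Bendixson rank at
   most t. The value f 0 bounds the indices of the accumulation points of top
   rank, and slice f n describes the part in the n-th annulus around them. *)
Inductive hull : T -> (nat -> nat) -> rat -> Prop :=
| hull_center t f i : (i <= f 0)%N -> hull t f (ratn i)
| hull_annulus t f i n j q : (i <= f 0)%N -> (j <= slice f n 0)%N ->
    lt (e t j) t -> hull (e t j) (slice f n) q -> annulus i n q -> hull t f q.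

Lemma hullE t f : hull t f = \bigcup_(i in [set i | (i <= f 0)%N])
  ([set ratn i] `|` \bigcup_n
     ((\bigcup_(j in [set j | (j <= slice f n 0)%N /\ lt (e t j) t])
         hull (e t j) (slice f n)) `&` annulus i n)).
Proof.
apply/seteqP; split=> q.
  case=> {t f q} [t f i fi|t f i n j q fi fj ltj hq iq]; exists i => //; first by left.
  by right; exists n => //; split=> //; exists j.
move=> [i fi [->|[n _ [[j [fj ltj] hq] iq]]]]; first exact: hull_center.
exact: hull_annulus fi fj ltj hq iq.
Qed.

(** For each of the finitely many centres, the annular pieces are compact by induction on [t] and
    shrink to the centre. *)
Lemma compact_hull t f : compact (hull t f : set Qspace).
Proof.
elim/(well_founded_induction lt_wf): t f => t IH f.
have finle m (P : nat -> Prop) : finite_set [set j : nat | (j <= m)%N /\ P j].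
  by apply: sub_finite_set (finite_II m.+1) => j [].
rewrite hullE; apply: (@compact_bigcup_finite Qspace nat) => [|i _].
  by apply: sub_finite_set (finite_II (f 0%N).+1) => j.
apply: (@compact_cvg_bigcup Qspace) => [n|U /nbhs_QspaceP[r r0 rU]].
  apply: (@compact_closedI Qspace); last exact: closed_annulus.
  apply: (@compact_bigcup_finite Qspace nat); first exact: finle.
  by move=> j [_ /IH].
have [N NP] := annulus_small i r0; exists N => n /NP nr q [_ /nr qr].
exact: rU.
Qed.

Lemma hull_mono t f g q : (forall n, (f n <= g n)%N) -> hull t f q -> hull t g q.
Proof.
move=> fg ht; elim: ht g fg => {t f q} [t f i fi g fg|].
  by apply: hull_center; exact: leq_trans (fg 0%N).
move=> t f i n j q fi fj ltj _ IH iq g fg.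
apply: (hull_annulus (leq_trans fi (fg _)) (leq_trans fj (fg _)) ltj _ iq).
by apply: IH => k; exact: fg.
Qed.

(** This is how the rank grows: pieces in the annuli around one point, absorbed at stages below [t],
    are absorbed together at stage [t], a single function coding all their parameters. *)
Lemma hull_glue t i (A : set rat) (u : nat -> T) (g : nat -> nat -> nat) :
  (forall n, lt (u n) t) -> (forall n, A `&` annulus i n `<=` hull (u n) (g n)) ->
  exists f, A `<=` hull t f.
Proof.
move=> ut Ahull; have /choice[j jP] : forall n, exists j, e t j = u n.
  by move=> n; exact: e_surj.
(* The maximum with [i] at every argument secures [i <= f 0], whatever pair 0 codes. *)
pose f m := maxn i
  (if unpickle m is Some (n, k) then maxn (j n) (g n k) else 0%N).
have fi m : (i <= f m)%N by exact: leq_maxl.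
have fE n k : slice f n k = maxn i (maxn (j n) (g n k)).
  by rewrite /slice /f pickleK.
exists f => q Aq; have [->|/annulus_cover[n qn]] := pselect (q = ratn i).
  exact: hull_center.
apply: (@hull_annulus t f i n (j n)) => //.
- by rewrite fE !leq_max leqnn orbT.
- by rewrite jP.
- rewrite jP; apply: (@hull_mono _ (g n)); last exact: Ahull.
  by move=> k; rewrite fE !leq_max leqnn !orbT.
Qed.

Lemma hull_lt s t g : lt s t -> exists f, hull s g `<=` hull t f.
Proof.
by move=> st; apply: (@hull_glue t 0%N _ (fun=> s) (fun=> g)) => // n q [].
Qed.

Variable W : set T.
Hypothesis W0 : W !=set0.
Hypothesis W_cof : forall u : nat -> T, (forall n, W (u n)) ->
  exists2 t, W t & forall n, lt (u n) t.

Let absorbed (A : set rat) := exists2 t, W t & exists f, A `<=` hull t f.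

Let absorbedS (A B : set rat) : A `<=` B -> absorbed B -> absorbed A.
Proof.
by move=> AB [t Wt [f Bf]]; exists t => //; exists f; exact: subset_trans Bf.
Qed.

Let absorbedU (A B : set rat) : absorbed A -> absorbed B -> absorbed (A `|` B).
Proof.
move=> [s Ws [f Af]] [t Wt [g Bg]].
have [|r Wr rP] := W_cof (u := fun n => if n is 0%N then s else t).
  by case.
have [f' ff'] := hull_lt f (rP 0%N); have [g' gg'] := hull_lt g (rP 1%N).
exists r => //; exists (fun n => maxn (f' n) (g' n)) => q [/Af/ff'|/Bg/gg'].
  by apply: hull_mono => n; exact: leq_maxl.
by apply: hull_mono => n; exact: leq_maxr.
Qed.

(* The points of A near which A is not absorbed form a compact set; an isolated
   point of it would contradict the gluing lemma. *)
Lemma hull_cofinal (A : set Qspace) : compact A ->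
  exists2 t, W t & exists f, A `<=` hull t f.
Proof.
move=> cA; rewrite -/(absorbed A); apply: contrapT => nA.
have abs_ind (B : set Qspace) : compact B ->
    (forall x, B x -> exists2 U, nbhs x U & absorbed (B `&` U)) -> absorbed B.
  apply: (@compact_ind Qspace absorbed) => //.
  by have [t Wt] := W0; exists t => //; exists id.
pose A' : set Qspace := A `&` [set x | forall U, nbhs x U -> ~ absorbed (A `&` U)].
have cA' : compact A'.
  apply: (@compact_closedI Qspace) => // x clx U /nbhs_interior Ux.
  have [y [yA Uy]] := clx _ Ux; move=> aU; apply: (yA U) => //.
have [q [Aq qA'] [r r0 rP]] : exists2 q : rat, A' q &
    exists2 e : rat, 0 < e & forall x, A' x -> `|q - x| < e -> x = q.
  apply: compact_Qspace_isolated => //; apply: contrapT => A'0; apply: nA.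
  apply: abs_ind => // x Ax; apply: contrapT => nU; apply: A'0; exists x.
  by split=> // U Ux aU; apply: nU; exists U.
(* By halving [r], [q] is the only point of [A'] in [B]. The annuli around [q] omit [q], so their
   traces on [B] are locally absorbed, hence absorbed. *)
pose B : set Qspace := A `&` [set x : rat | `|q - x| <= r / 2].
have Bx n x : (B `&` annulus (pickle q) n) x -> ~ A' x.
  move=> [[Ax /= xr]] + A'x; have -> : x = q.
    apply: rP => //; apply: le_lt_trans xr _.
    by rewrite ltr_pdivrMr// ltr_pMr// ltr1n.
  by rewrite /annulus /= ratn_pickle subrr normr0 !mulr0 ler10 andbF.
have cB : compact B.
  by apply: (@compact_closedI Qspace) => //; exact: closed_Qspace_ball.
have /choice[u uP] : forall n, exists u : T * (nat -> nat),
    W u.1 /\ B `&` annulus (pickle q) n `<=` hull u.1 u.2.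
  move=> n; suff [t Wt [f fP]] : absorbed (B `&` annulus (pickle q) n).
    by exists (t, f).
  apply: abs_ind.
    by apply: (@compact_closedI Qspace) => //; exact: closed_annulus.
  move=> x Bnx; have /= [[Ax _] _] := Bnx; apply: contrapT => nU.
  apply: (Bx n x Bnx); split=> // U Ux aU; apply: nU; exists U => //.
  by apply: absorbedS aU => y [[[]]].
have [n|t Wt tP] := W_cof (u := fun n => (u n).1); first by have [] := uP n.
have [n|f Bf] := hull_glue (i := pickle q) (A := B) (g := fun n => (u n).2) tP.
  by have [] := uP n.
apply: (qA' [set x : rat | `|q - x| < r / 2]).
  by apply: nbhs_Qspace_ball; rewrite divr_gt0.
exists t => //; exists f => x [Ax /= xr]; apply: Bf; split=> //=; exact: ltW.
Qed.

End Hulls.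

Lemma uncountable_hulls (T : choiceType) (D : set T) : ~ countable D ->
  exists H : T -> (nat -> nat) -> set rat,
  [/\ forall t f, compact (H t f : set Qspace),
      forall t f g, (forall n, (f n <= g n)%N) -> H t f `<=` H t g
    & forall A : set Qspace, compact A ->
        exists2 t, D t & exists f, A `<=` H t f].
Proof.
move=> /omega1_relation[W [lt [WD W0 lt_wf lt_count W_cof]]].
have /choice[e eP] : forall t, exists e : nat -> T,
    forall s, lt s t -> exists j, e j = s.
  move=> t; have /countable_injP[f fI] := lt_count t.
  (* A number that indexes no predecessor is sent to [t] itself, which is why [hull] demands
     [lt (e t j) t]. *)
  exists (fun j => xget t [set s | lt s t /\ f s = j]) => s st; exists (f s).
  case: xgetP => [x _ [xt fxs]|/(_ s)[]//].
  by apply: fI => //; rewrite inE.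
have e_surj s t : lt s t -> exists j, e t j = s by exact: eP.
exists (hull lt e); split=> [||A cA].
- exact: compact_hull.
- by move=> t f g fg q; exact: hull_mono.
- by have [t /WD Dt ?] := hull_cofinal e_surj W0 W_cof cA; exists t.
Qed.

(** * Separated sets in metric spaces *)

Section Metric.
Variables (R : realType) (M : topologicalType) (d : M -> M -> R).
Hypothesis d_eq0 : forall x y, d x y = 0 <-> x = y.
Hypothesis d_sym : forall x y, d x y = d y x.
Hypothesis d_tri : forall x y z, d x z <= d x y + d y z.
Hypothesis nbhs_d : forall x A, nbhs x A <->
  exists2 e : R, 0 < e & [set y | d x y < e] `<=` A.

Let dxx x : d x x = 0. Proof. exact/d_eq0. Qed.

Let nbhs_dball x (r : R) : 0 < r -> nbhs x [set y | d x y < r].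
Proof. by move=> r0; apply/nbhs_d; exists r. Qed.

Let open_dball x (r : R) : open [set y | d x y < r].
Proof.
rewrite openE => y /= xy; apply/nbhs_d; exists (r - d x y); rewrite ?subr_gt0//.
by move=> z /= yz; apply: le_lt_trans (d_tri _ y _) _; rewrite addrC -ltrBrDr.
Qed.

Let closed_dball x (r : R) : closed [set y | d x y <= r].
Proof.
move=> y cly /=; rewrite leNgt; apply/negP => lt_r.
have /cly[z [/= xz yz]] : nbhs y [set z | d y z < d x y - r].
  by apply: nbhs_dball; rewrite subr_gt0.
by have := d_tri x z y; rewrite (d_sym z y); move: xz yz lt_r; lra.
Qed.

Definition spaced (r : R) (D : set M) :=
  forall x y, D x -> D y -> x <> y -> r <= d x y.

Lemma maximal_separated (r : R) (C : set M) : 0 < r ->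
  exists D, [/\ D `<=` C, spaced r D &
    forall x, C x -> exists2 y, D y & d x y < r].
Proof.
move=> r0; have [D [[DC sD] maxD]] :
    exists D, (D `<=` C /\ spaced r D) /\
      forall E, D `<` E -> ~ (E `<=` C /\ spaced r E).
  apply: Zorn_bigcup => F FP Ftot; split=> [x [A FA Ax]|x y [A FA Ax] [B FB By]].
    by have [+ _] := FP _ FA; apply.
  have [AB|BA] := Ftot _ _ FA FB.
    by have [_] := FP _ FB; apply => //; exact: AB.
  by have [_] := FP _ FA; apply => //; exact: BA.
exists D; split=> // x Cx; apply: contrapT => nx.
have far y : D y -> r <= d x y.
  by move=> Dy; rewrite leNgt; apply/negP => xy; apply: nx; exists y.
apply: (maxD (D `|` [set x])).
  split=> [y Dy|]; first by left.
  by move=> /(_ x (or_intror erefl)) /far; rewrite dxx leNgt r0.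
split=> [y [/DC//|->//]|y z [Dy|->] [Dz|->] // yz].
- exact: sD.
- by rewrite d_sym; exact: far.
- exact: far.
Qed.

(** Two points of [D] in this ball would be less than [r] apart, so there is at most one. *)
Lemma finite_separated_ball (r : R) (D : set M) x : spaced r D ->
  finite_set (D `&` [set y | d x y < r / 2]).
Proof.
move=> sD; have [[y [Dy /= xy]]|nD] := pselect (D `&` [set y | d x y < r / 2] !=set0).
  apply: sub_finite_set (finite_set1 y) => z [Dz /= xz]; apply: contrapT => zy.
  have := sD _ _ Dz Dy zy; apply/negP; rewrite -ltNge.
  by have := d_tri z x y; rewrite (d_sym z x); move: xy xz; lra.
by apply: sub_finite_set (finite_set0 M) => z Dz; apply: nD; exists z.
Qed.

Lemma finite_separated_compact (r : R) (D A : set M) : 0 < r -> spaced r D ->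
  compact A -> finite_set (D `&` A).
Proof.
move=> r0 sD cA; apply: (@compact_ind M (fun B => finite_set (D `&` B))) cA _.
- by rewrite setI0.
- by move=> B C; rewrite setIUr finite_setU.
- by move=> B C BC; apply: sub_finite_set; exact: setIS.
move=> x _; exists [set y | d x y < r / 2]; first by apply: nbhs_dball; rewrite divr_gt0.
by apply: sub_finite_set (finite_separated_ball x sD) => y [Dy []].
Qed.

Lemma exists_invS_lt (r : R) : 0 < r -> exists n, n.+1%:R^-1 < r.
Proof.
move=> r0; exists (Num.truncn r^-1); rewrite invf_plt ?posrE//; exact: truncnS_gt.
Qed.

(** With [D n] maximal, the balls of radius 1/(n+1) centred in the sets [D n] form a basis. *)
Lemma separated_weight : exists D : nat -> set M,
  (forall n, spaced n.+1%:R^-1 (D n)) /\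
  weight M #<= [set p : nat * M | D p.1 p.2].
Proof.
have /choice[D DP] : forall n, exists D, [/\ D `<=` setT, spaced n.+1%:R^-1 D &
    forall x, setT x -> exists2 y, D y & d x y < n.+1%:R^-1].
  by move=> n; apply: maximal_separated; rewrite invr_gt0.
exists D; split=> [n|]; first by have [] := DP n.
pose b (p : nat * M) := [set y | d p.2 y < p.1.+1%:R^-1].
apply: card_le_trans (card_image_le b _); apply: (weightP M).2; split.
  by move=> _ [p _ <-]; exact: open_dball.
move=> x U /nbhs_d[r r0 rU].
have [|n nr] := @exists_invS_lt (r / 2); first by rewrite divr_gt0.
have [_ _ /(_ x I)[y Dy xy]] := DP n.
exists (b (n, y)) => /=; first by split; [exists (n, y) | rewrite /b /= d_sym].
move=> z /= yz; apply: rU; apply: le_lt_trans (d_tri _ y _) _.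
by rewrite [r]splitr ltrD//; [exact: lt_trans xy _ | exact: lt_trans yz _].
Qed.

Lemma uncountable_separated (D : nat -> set M) :
  weight M #<= [set p : nat * M | D p.1 p.2] -> ~ countable (weight M) ->
  exists n, ~ countable (D n).
Proof.
move=> leD; apply: contra_notP => nD; apply: sub_countable leD _.
have -> : [set p : nat * M | D p.1 p.2] = \bigcup_n ((fun x => (n, x)) @` D n).
  apply/seteqP; split=> [[n x] Dx|_ [n _ [x Dx <-]]//].
  by exists n => //; exists x.
apply: bigcup_countable => // n _.
apply: sub_countable (card_image_le _ _) _.
by apply: contrapT => uD; apply: nD; exists n.
Qed.

(** Otherwise every sequence in [C] accumulates at a point of [C]. Then separated subsets of [C] are
    finite, so an ultrafilter on [C] contains a ball of each radius 1/(n+1), and it converges to an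
    accumulation point of the centres. *)
Lemma noncompact_sequence (C : set M) : closed C -> ~ compact C ->
  exists x : nat -> M, (forall k, C (x k)) /\
    forall A, compact A -> finite_set [set k | A (x k)].
Proof.
move=> clC; apply: contra_notP => nx.
have clust (x : nat -> M) : (forall k, C (x k)) ->
    exists2 y, C y & forall U, nbhs y U -> infinite_set [set k | U (x k)].
  move=> Cx; apply: contrapT => ny; apply: nx; exists x; split=> // A cA.
  apply: compact_finite_preimage cA => y Ay; apply: contrapT => nU; apply: ny.
  exists y => [|U Uy fU]; last by apply: nU; exists U.
  apply: clC => U Uy; apply: contrapT => CU; apply: nU; exists U => //.
  apply: sub_finite_set (finite_set0 nat) => k Uk; apply: CU.
  by exists (x k).
have /choice[D DP] : forall n, exists D, [/\ D `<=` C, spaced n.+1%:R^-1 D &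
    forall x, C x -> exists2 y, D y & d x y < n.+1%:R^-1].
  by move=> n; apply: maximal_separated; rewrite invr_gt0.
have finD n : finite_set (D n).
  have [DC sD _] := DP n; apply: contrapT => /infiniteP/card_leP[f].
  pose x k := val (f (SigSub (mem_set I : k \in [set: nat]))).
  have Dx k : D n (x k) by apply/set_mem; exact: valP.
  have [|y Cy yP] := clust x; first by move=> k; exact/DC.
  apply: (yP [set z | d y z < n.+1%:R^-1 / 2]).
    by apply: nbhs_dball; rewrite divr_gt0// invr_gt0.
  have xI : injective x.
    by move=> k l /val_inj/inj klE; have /(congr1 val) := klE (mem_set I) (mem_set I).
  have := finite_preimage (in2W xI) (finite_separated_ball y sD).
  by apply: sub_finite_set => k yk; split.
rewrite compact_ultra => F FU FC.
have /choice[y yP] : forall n, exists y,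
    C y /\ F [set z | d y z < n.+1%:R^-1].
  move=> n; have [DC _ Dcov] := DP n; apply: contrapT => nF.
  have FD z : D n z -> F (~` [set t | d z t < n.+1%:R^-1]).
    move=> Dz; have [Fz|//] := in_ultra_setVsetC [set t | d z t < n.+1%:R^-1] FU.
    by exfalso; apply: nF; exists z; split=> //; exact: DC.
  have /filter_ex[t [Ct]] : F (C `&` \bigcap_(z in D n) ~` [set t | d z t < n.+1%:R^-1]).
    apply: filterI => //.
    have /finite_fsetP[S SE] := finD n; rewrite SE; apply: filter_bigI => z zS.
    by apply: FD; rewrite SE.
  by have [z Dz tz] := Dcov t Ct; move=> /(_ z Dz); apply; rewrite /= d_sym.
have [k|x Cx xP] := clust y; first by have [] := yP k.
exists x; split=> // U /nbhs_d[r r0 rU].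
have [|N Nr] := @exists_invS_lt (r / 2); first by rewrite divr_gt0.
(* As the centres accumulate at [x], some ball in [F] has both its centre close to [x] and a small
   radius. *)
have [n [Nn xn]] : exists n, (N <= n)%N /\ d x (y n) < r / 2.
  apply: contrapT => nn; apply: (xP [set z | d x z < r / 2]).
    by apply: nbhs_dball; rewrite divr_gt0.
  apply: sub_finite_set (finite_II N) => n /= xn; rewrite ltnNge; apply/negP => Nn.
  by apply: nn; exists n.
have [_] := yP n; apply: filterS => z /= nz; apply: rU.
apply: le_lt_trans (d_tri _ (y n) _) _; rewrite [r]splitr ltrD//.
apply: lt_trans nz _; apply: le_lt_trans Nr.
by rewrite lef_pV2 ?posrE// ler_nat.
Qed.

(* The bound n |-> f n is read off closed discrete sequences in the balls of
   radius 1/n around a point without compact neighbourhoods. *)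
Lemma not_locally_compact_bound : ~ locally_compact [set: M] ->
  exists bnd : set M -> (nat -> nat) -> Prop,
    (forall A, compact A -> exists f, bnd A f) /\
    (forall f, exists2 A0, compact A0 &
       forall A g, A0 `<=` A -> bnd A g -> forall n, (f n <= g n)%N).
Proof.
move=> nlc; have [p np] : exists p : M, ~ compact_near (within setT (nbhs p)).
  by apply: contrapT => np; apply: nlc => x _; apply: contrapT => nx; apply: np; exists x.
have /choice[x xP] : forall n, exists x : nat -> M,
    (forall k, d p (x k) <= n.+1%:R^-1) /\
    forall A, compact A -> finite_set [set k | A (x k)].
  move=> n; apply: (@noncompact_sequence [set y | d p y <= n.+1%:R^-1]).
    exact: closed_dball.
  move=> cb; apply: np; exists [set y | d p y <= n.+1%:R^-1]; last first.
    by split=> //; exact: closed_dball.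
  apply: filterS (@nbhs_dball p n.+1%:R^-1 _); last by rewrite invr_gt0.
  by move=> y /ltW.
exists (fun A f => forall n k, A (x n k) -> (k <= f n)%N); split=> [A cA|f].
  have /choice[f fP] : forall n, exists N, forall k, A (x n k) -> (k <= N)%N.
    by move=> n; apply: finite_set_ubound; have [_] := xP n; apply.
  by exists f.
exists ([set p] `|` \bigcup_n (x n @` [set k | (k <= f n)%N])); last first.
  move=> A g A0A gP n; apply: gP; apply: A0A; right; exists n => //.
  by exists (f n) => //=.
apply: compact_cvg_bigcup => [n|U /nbhs_d[r r0 rU]].
  apply: finite_compact; apply: finite_image.
  by apply: sub_finite_set (finite_II (f n).+1) => k.
have [N Nr] := exists_invS_lt r0; exists N => n Nn _ [k _ <-]; apply: rU => /=.
have [+ _] := xP n => /(_ k) /le_lt_trans; apply; apply: le_lt_trans Nr.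
by rewrite lef_pV2 ?posrE// ler_nat.
Qed.

End Metric.

(** * The Tukey quotients *)

Lemma Qspace_metrizable (R : realType) : metrizable R Qspace.
Proof.
exists (fun x y : rat => ratr `|x - y|); split=> [x y|x y|x y z|x A].
- split=> [/eqP|->]; last by rewrite subrr normr0 rmorph0.
  by rewrite fmorph_eq0 normr_eq0 subr_eq0 => /eqP.
- by rewrite distrC.
- by rewrite -rmorphD/= ler_rat; exact: ler_distD.
- split=> [/nbhs_QspaceP[e e0 eA]|[e e0 eA]].
    by exists (ratr e) => [|y /=]; rewrite ?ltr0q// ltr_rat; exact: eA.
  have [q] := rat_in_itvoo e0; rewrite in_itv/= ltr0q => /andP[q0 qe].
  apply/nbhs_QspaceP; exists q => // y xy; apply: eA => /=.
  by apply: lt_trans qe; rewrite ltr_rat.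
Qed.

(** A compact ball around 0 would have an isolated point by [compact_Qspace_isolated]; a small shift
    within the ball refutes this. *)
Lemma Qspace_not_locally_compact : ~ locally_compact [set: Qspace].
Proof.
move=> /(_ (0 : rat) I)[U U0 [cU _]].
have /nbhs_QspaceP[e e0 eU] : nbhs ((0 : rat) : Qspace) U.
  by move: U0; rewrite withinET.
pose A : set Qspace := U `&` [set x : rat | `|0 - x| <= e / 2].
have AP (x : rat) : `|x| <= e / 2 -> A x.
  move=> xe; split; last by rewrite /= sub0r normrN.
  apply: eU; rewrite /= sub0r normrN; apply: le_lt_trans xe _; move: e0; lra.
have [||q [_ /=] + [r r0 rP]] := @compact_Qspace_isolated A.
- by apply: (@compact_closedI Qspace) => //; exact: closed_Qspace_ball.
- by exists (0 : rat); apply: AP; rewrite normr0; move: e0; lra.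
rewrite sub0r normrN ler_norml => /andP[q1 q2].
(* Being less than [r] and than the radius e/2, the shift [s] can be subtracted from q >= 0, or
   added to q < 0, without leaving the ball. *)
pose s := Num.min r (e / 2) / 2.
have /andP[sr se] : (s < r) && (s < e / 2).
  have : (Num.min r (e / 2) <= r) && (Num.min r (e / 2) <= e / 2).
    by rewrite !ge_min !lexx orbT.
  have : 0 < Num.min r (e / 2) by rewrite lt_min r0 divr_gt0.
  rewrite /s; move: r0 e0; lra.
have s0 : 0 < s by rewrite divr_gt0// lt_min r0 divr_gt0.
have [q0|q0] := leP 0 q.
  have Aqs : A (q - s) by apply: AP; rewrite ler_norml; move: q0 q1 q2 se s0; lra.
  by have := rP _ Aqs; rewrite subKr gtr0_norm// => /(_ sr); move: s0; lra.
have Aqs : A (q + s) by apply: AP; rewrite ler_norml; move: q0 q1 q2 se s0; lra.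
have := rP _ Aqs; rewrite opprD addNKr normrN gtr0_norm// => /(_ sr).
by move: s0; lra.
Qed.

(** Applied to the rationals, this turns cofinal subsets of K(Q) into dominating families. *)
Lemma K_ge_omega_omega (R : realType) (M : topologicalType) : metrizable R M ->
  ~ locally_compact [set: M] -> tukey_ge (K M) omega_omega.
Proof.
move=> [d [d0 dsym dtri dnbhs]] nlc.
have [bnd [bndP bnd_cof]] := not_locally_compact_bound d0 dsym dtri dnbhs nlc.
apply: (@tukey_geI (K M) omega_omega (fun A f => bnd (sval A) f)) => [[A cA]|f].
  exact: bndP.
have [A0 cA0 A0P] := bnd_cof f; exists (exist _ A0 cA0) => -[A cA] g.
exact: A0P.
Qed.

(** By diagonalization. A dominating family can thus be the index set in [uncountable_hulls]. *)
Lemma uncountable_cofinal_omega_omega (C : set (nat -> nat)) :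
  @cofinal omega_omega C -> ~ countable C.
Proof.
move=> cofC /(@pcard_surjP _ _ C)[u uC].
have [f /uC[n _ <-] /(_ n)] := cofC (fun n => (u n n).+1).
by rewrite /= ltnn.
Qed.

(** A compact A goes to the union of the hulls [H t f], with t in the finite trace of A on an
    uncountable separated set and f a bound read off from A. *)
Lemma K_ge_of_not_locally_compact (R : realType) (M : topologicalType) :
  metrizable R M -> ~ countable (weight M) -> ~ locally_compact [set: M] ->
  tukey_ge (K M) (K Qspace).
Proof.
move=> [d [d0 dsym dtri dnbhs]] uM nlc.
have [bnd [bndP bnd_cof]] := not_locally_compact_bound d0 dsym dtri dnbhs nlc.
have [D [sD leD]] := separated_weight d0 dsym dtri dnbhs.
have [n uD] := uncountable_separated leD uM.
have [H [cH Hmono Hcof]] := uncountable_hulls uD.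
apply: (@tukey_geI (K M) (K Qspace) (fun A B => exists2 f, bnd (sval A) f &
  sval B = \bigcup_(t in D n `&` sval A) H t f)) => [[A cA]|[B cB]].
  have [f Af] := bndP A cA.
  have cU : compact (\bigcup_(t in D n `&` A) H t f : set Qspace).
    apply: (@compact_bigcup_finite Qspace) => //.
    apply: (finite_separated_compact dsym dtri dnbhs) (sD n) cA.
    by rewrite invr_gt0.
  by exists (exist _ _ cU), f.
have [t Dt [f Bf]] := Hcof B cB; have [A0 cA0 A0P] := bnd_cof f.
(* [A0] forces the bound to be at least [f], and the added point puts [t] in the trace. *)
exists (exist _ _ (compactU cA0 (@compact_set1 M t))) => -[A cA] [B' cB'].
rewrite /dle /= => A0A [g Ag ->] q /Bf Hq; exists t.
  by split=> //; apply: A0A; right.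
by apply: Hmono Hq; apply: A0P Ag => x A0x; apply: A0A; left.
Qed.

(* The separated points x in A only give pairs (n, x) for finitely many x; the
   bound on n comes from the trace of A on a fixed sequence of separated points,
   which avoids the cardinal arithmetic of w(M) * omega = w(M). *)
Lemma K_ge_of_dominating_le_weight (R : realType) (M : topologicalType) :
  metrizable R M -> ~ countable (weight M) -> dominating_number #<= weight M ->
  tukey_ge (K M) (K Qspace).
Proof.
move=> [d [d0 dsym dtri dnbhs]] uM le_dw.
have [D [sD leD]] := separated_weight d0 dsym dtri dnbhs.
have finD n (A : set M) : compact A -> finite_set (D n `&` A).
  by apply: (finite_separated_compact dsym dtri dnbhs) (sD n); rewrite invr_gt0.
have [m uD] := uncountable_separated leD uM.
have [y [yI yD]] : exists y : nat -> M, injective y /\ forall k, D m (y k).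
  have /infiniteP/card_leP[f] : infinite_set (D m).
    by apply: contra_not uD; exact: finite_set_countable.
  exists (fun k => val (f (SigSub (mem_set I : k \in [set: nat])))); split.
    move=> k l /val_inj/inj klE.
    by have /(congr1 val) := klE (mem_set I) (mem_set I).
  by move=> k; apply/set_mem; exact: valP.
have [dom_cof _] := dominating_numberP.
have [H [cH Hmono Hcof]] :=
  uncountable_hulls (uncountable_cofinal_omega_omega dom_cof).
have /pcard_surjP[h hP] := card_le_trans le_dw leD.
(* The values of [h] at the pairs (n, x) cover the dominating family; restricting to x in [A] and n
   up to [N] leaves finitely many when [A] is compact. *)
pose S (A : set M) N := h @` [set p | [/\ D p.1 p.2, A p.2 & (p.1 <= N)%N]].
have finS A N : compact A -> finite_set (S A N).
  move=> cA; apply: finite_image; apply: (@sub_finite_set _ _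
    (\bigcup_(n in [set n | (n <= N)%N]) ((fun x => (n, x)) @` (D n `&` A)))).
    by move=> [n x] [Dx Ax nN]; exists n => //; exists x.
  apply: bigcup_finite => [|n _]; last exact/finite_image/finD.
  by apply: sub_finite_set (finite_II N.+1) => n.
apply: (@tukey_geI (K M) (K Qspace) (fun A B => exists2 N,
    forall k, sval A (y k) -> (k <= N)%N &
    sval B = \bigcup_(t in S (sval A) N) \bigcup_(f in S (sval A) N) H t f))
    => [[A cA]|[B cB]].
  have [N NP] : exists N, forall k, A (y k) -> (k <= N)%N.
    apply: finite_set_ubound.
    have := finite_preimage (in2W yI) (finD m A cA).
    by apply: sub_finite_set => k Ak; split.
  have cU : compact (\bigcup_(t in S A N) \bigcup_(f in S A N) H t f : set Qspace).
    apply: (@compact_bigcup_finite Qspace) => [|t _]; first exact: finS.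
    by apply: (@compact_bigcup_finite Qspace) => //; exact: finS.
  by exists (exist _ _ cU), N.
have [t /hP[[n x] /= Dx <-] [f Bf]] := Hcof B cB.
have [g /hP[[n' x'] /= Dx' <-] fg] := dom_cof f.
(* The points [x] and [x'] name [t] and a function above [f]; the third point forces [N] to be at
   least [n] and [n']. *)
have cA0 : compact [set x; x'; y (maxn n n')].
  by do 2?[apply: compactU]; exact: compact_set1.
exists (exist _ _ cA0) => -[A cA] [B' cB']; rewrite /dle /= => A0A [N NP ->].
have maxN : (maxn n n' <= N)%N by apply: NP; apply: A0A; right.
move=> q /Bf Hq; exists (h (n, x)).
  exists (n, x) => //; split=> //=; last exact: leq_trans (leq_maxl _ _) maxN.
  by apply: A0A; left; left.
exists (h (n', x')); last exact: Hmono Hq.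
exists (n', x') => //; split=> //=; last exact: leq_trans (leq_maxr _ _) maxN.
by apply: A0A; left; right.
Qed.

(** Finitely many basic open sets, each inside a compact set, cover a given compact set. With one
    compact superset chosen for each, the finite unions are cofinal, and [card_seqs_in] counts
    them. *)
Lemma K_cofinal_weight (M : topologicalType) : locally_compact [set: M] ->
  infinite_set (weight M) ->
  exists2 C, @cofinal (K M) C & C #<= weight M.
Proof.
move=> lc iw; have [[wo wb] _] := weightP M.
have /choice[c cP] : forall U : set M, exists C : set M,
    compact C /\ ((exists2 C', compact C' & U `<=` C') -> U `<=` C).
  move=> U; have [[C cC UC]|nC] := pselect (exists2 C', compact C' & U `<=` C').
    by exists C.
  by exists set0; split=> [|/nC//]; exact: compact0.
pose F (s : seq (set M)) : K M := exist _ _ (@bigsetU_compact M _ c s xpredT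
  (fun U _ => (cP U).1)).
exists (F @` seqs_in (weight M)); last first.
  by apply: card_le_trans (card_image_le _ _) _; exact: card_seqs_in.
move=> [A cA].
suff [s sw As] : exists2 s, seqs_in (weight M) s &
    A `<=` \big[setU/set0]_(U <- s) c U.
  by exists (F s) => //; exists s.
apply: (@compact_ind M (fun B => exists2 s, seqs_in (weight M) s &
    B `<=` \big[setU/set0]_(U <- s) c U)) cA _.
- by exists [::].
- move=> B C [s sw Bs] [t tw Ct]; exists (s ++ t).
    by move=> U; rewrite mem_cat => /orP[/sw|/tw].
  by rewrite big_cat; exact: setUSS.
- by move=> B C BC [s sw Cs]; exists s => //; exact: subset_trans Cs.
move=> x _; have [V Vx [cV _]] := lc x I.
have {}Vx : nbhs x V by move: Vx; rewrite withinET.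
have [U [wU Ux] UV] := wb x V Vx.
exists U; first by apply: open_nbhs_nbhs; split=> //; exact: wo.
exists [:: U]; first by move=> W; rewrite inE => /eqP->.
rewrite big_seq1; apply: subset_trans ((cP U).2 _); first exact: subIsetr.
by exists V.
Qed.

Theorem lemma37 (R : realType) (M : topologicalType)
    (Mmetrizable : metrizable R M) (Muncountable : ~ countable (weight M)) :
  (~ locally_compact [set: M] -> tukey_ge (K M) (K Qspace)) /\
  (locally_compact [set: M] ->
     (tukey_ge (K M) (K Qspace) <-> dominating_number #<= weight M)).
Proof.
split=> [|lc]; first exact: K_ge_of_not_locally_compact Mmetrizable _.
split=> [MQ|]; last exact: K_ge_of_dominating_le_weight Mmetrizable _.
have Qomega := K_ge_omega_omega (Qspace_metrizable R) Qspace_not_locally_compact.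
have [phi phiP] := tukey_ge_trans MQ Qomega.
have [|C cofC leC] := K_cofinal_weight lc.
  by apply: contra_not Muncountable; exact: finite_set_countable.
have [_ dom_min] := dominating_numberP.
(* The composite quotient carries a cofinal subset of K(M) of size at most w(M) to a dominating
   family. *)
apply: card_le_trans (dom_min _ (phiP _ cofC)) _.
exact: card_le_trans (card_image_le _ _) leC.
Qed.
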